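(* Let $n = 2^c$ with $c$ a positive integer, so $c = \log_2 n$. Consider the following random graph model on vertex set $V=\{1,\dots,n\}$: a fixed set $P\subseteq V$ of $c$ distinct vertices (the planted clique) has all $\binom{c}{2}$ edges among its vertices present, and every other pair $\{u,v\}$ of distinct vertices (i.e. not both in $P$) is an edge independently with the same probability $\alpha$. Then there exist $\alpha \le 1/(2k_0)$, where $k_0$ is at most polylogarithmic in $n$, and $n_0$ such that for all $n \ge n_0$ the probability that the graph contains a clique of size $\log_2 n$ other than $P$ (a ''non-planted'' clique) is less than $$\frac{2\,(c\,2^c)}{(2c)^{c-1}}, \qquad c=\log_2 n.$$
   Context: In the paper, the graph arises as a Bloom-filter succinct representation: a binary array $SG$ of polylogarithmic length (e.g. $2k_0\log^2 n$ bits) has a bit set to one exactly at the hash values $h(i,j)$ of the edges $(i,j)$, $i<j$, of a clique on $\log_2 n$ randomly chosen vertices, and an arbitrary pair $(u,v)$, $u<v$, is an edge iff $SG[h(u,v)]=1$; $\alpha$ is the fraction of ones in $SG$. The theorem is stated under the explicit modelling assumption that, apart from the planted clique edges, edge existence events are independent and each occurs with probability $\alpha$, as formalized in the claim. All logarithms are base 2. *)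

(* Defs.v *)
From HB Require Import structures.
From mathcomp Require Export all_boot all_order all_algebra.
From mathcomp Require Export all_classical all_reals all_analysis.

Set Implicit Arguments.
Unset Strict Implicit.
Unset Printing Implicit Defensive.

Import Order.TTheory GRing.Theory Num.Theory.
Import numFieldNormedType.Exports.

Local Open Scope classical_set_scope.
Local Open Scope ring_scope.

Definition log2 (R : realType) (x : R) : R := ln x / ln 2.

Definition at_most_polylog (R : realType) (f : nat -> R) : Prop :=
  exists (C : R) (k : nat), \forall n \near \oo, f n <= C * log2 n%:R ^+ k.

Definition mutually_independent (d : measure_display) (T : measurableType d)
    (R : realType) (Pr : probability T R) (I : finType) (D : pred I)
    (E : I -> set T) : Prop :=
  forall J : {set I}, {subset J <= D} ->
    Pr (\bigcap_(i in [set` J]) E i) = (\prod_(i in J) Pr (E i))%E.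

Definition simple_graph (V : finType) (e : rel V) : Prop :=
  symmetric e /\ irreflexive e.

Definition is_clique (V : finType) (e : rel V) (Q : {set V}) : Prop :=
  forall u v, u \in Q -> v \in Q -> u != v -> e u v.

(* Unordered pairs of distinct vertices are encoded as (u, v) with u < v;
   the free ones are those that do not lie inside the planted set P. *)
Definition free_pair (n : nat) (P : {set 'I_n}) : pred ('I_n * 'I_n) :=
  fun e => (e.1 < e.2)%N && ~~ ((e.1 \in P) && (e.2 \in P)).

Definition edge_event (T : Type) (n : nat) (G : T -> rel 'I_n)
    (e : 'I_n * 'I_n) : set T :=
  [set t | G t e.1 e.2].

Definition planted_clique_model (d : measure_display) (T : measurableType d)
    (R : realType) (Pr : probability T R) (n : nat) (P : {set 'I_n})
    (alpha : R) (G : T -> rel 'I_n) : Prop :=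
  [/\ forall t, simple_graph (G t),
      forall e, measurable (edge_event G e),
      forall t, is_clique (G t) P,
      forall e, free_pair P e -> Pr (edge_event G e) = alpha%:E
    & mutually_independent Pr (free_pair P) (edge_event G)].

Definition nonplanted_clique_event (T : Type) (n : nat) (G : T -> rel 'I_n)
    (P : {set 'I_n}) (c : nat) : set T :=
  [set t | exists Q : {set 'I_n}, [/\ #|Q| = c, Q <> P & is_clique (G t) Q]].

(* Main.v *)
Require Import Defs.
From mathcomp Require Import all_boot all_order all_algebra.
From mathcomp Require Import all_classical all_reals all_analysis.
From mathcomp Require Import zify ring lra.
Set Implicit Arguments.
Unset Strict Implicit.
Unset Printing Implicit Defensive.

Import Order.TTheory GRing.Theory Num.Theory.
Import numFieldNormedType.Exports.
Local Open Scope ring_scope.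

(* Union bound over the sets Q <> P with #|Q| = c, grouped by j = #|Q :\: P|. With
   alpha = (2c)^-2: replacing j vertices of P can be done in at most (c n)^j ways,
   and Q then contains at least j (c - 1) / 2 free pairs, so Q is a clique with
   probability at most y^j where y = (2c)^-(c - 1). Hence the probability is at most
   the sum of x^j over 1 <= j <= c with x = c 2^c y, which is below 2 x as soon as
   x <= 1/2, i.e. as soon as c >= 4. *)

Lemma bin_leq_expn (n k : nat) : ('C(n, k) <= n ^ k)%N.
Proof.
elim: n k => [|n IHn] [|k] //; rewrite binS expnS mulSn addnC.
have mono i : (n ^ i <= n.+1 ^ i)%N by case: i => // i; rewrite leq_exp2r.
apply: leq_add; first exact: leq_trans (IHn k) (mono k).
by apply: leq_trans (IHn k.+1) _; rewrite expnS leq_mul2l mono orbT.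
Qed.

(* Each ordered pair [(u, v)] with [u] outside [P] gives a free pair, [(u, v)] or
   [(v, u)], and every free pair arises at most twice. *)
Lemma leq_card_free_pairs (n : nat) (P Q : {set 'I_n}) :
  (#|Q :\: P| * #|Q|.-1 <=
     #|[set e in free_pair P | (e.1 \in Q) && (e.2 \in Q)]|.*2)%N.
Proof.
set J := [set e in _ | _].
pose A := [set e : 'I_n * 'I_n | [&& e.1 \in Q :\: P, e.2 \in Q & e.2 != e.1]].
have cardA : #|A| = (#|Q :\: P| * #|Q|.-1)%N.
  rewrite -sum1_card (eq_bigl (fun e : 'I_n * 'I_n =>
    (e.1 \in Q :\: P) && (e.2 \in Q :\ e.1))); last first.
    by case=> u v; rewrite !inE /= (andbC (v != u)) ?andbA.
  rewrite -(pair_big_dep (fun u => u \in Q :\: P) (fun u v => v \in Q :\ u)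
    (fun _ _ => 1%N)) /= -sum_nat_const.
  apply: eq_bigr => u; rewrite inE => /andP[_ uQ].
  by rewrite sum1_card (cardsD1 u Q) uQ.
pose swap (e : 'I_n * 'I_n) := (e.2, e.1).
have swapK : injective swap by move=> [a b] [c d] [-> ->].
rewrite -cardA -addnn -{2}(card_imset J swapK).
apply: leq_trans (leq_of_leqif (leq_card_setU J (swap @: J))); apply: subset_leq_card.
have memE e : (e \in free_pair P) = free_pair P e by [].
apply/fintype.subsetP => -[u v]; rewrite !inE /= => /and3P[/andP[uP uQ] vQ vu].
have [uv|uv] := ltnP u v.
  by rewrite memE /free_pair /= uv uQ vQ (negbTE uP).
apply/orP; right; apply/imsetP; exists (v, u) => //.
rewrite inE memE /free_pair /= uQ vQ (negbTE uP) andbF /=.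
by rewrite ltn_neqAle vu uv.
Qed.

(** [Q] is recovered from what it drops from [P] and what it adds. Both parts have size [j], which
    leaves at most ['C(#|P|, j) * 'C(n, j)] choices. *)
Lemma card_sets_at_distance (n : nat) (P : {set 'I_n}) (j : nat) :
  (#|[set Q : {set 'I_n} | (#|Q| == #|P|) && (#|Q :\: P| == j)]|
     <= (#|P| * n) ^ j)%N.
Proof.
pose f (Q : {set 'I_n}) := (P :\: Q, Q :\: P).
have f_inj : injective f.
  move=> Q1 Q2 [e1 e2]; apply/setP => x.
  move/setP/(_ x): e1; move/setP/(_ x): e2; rewrite !inE.
  by case: (x \in P); case: (x \in Q1); case: (x \in Q2).
rewrite -(card_imset _ f_inj) expnMn.
pose D (B : {set 'I_n}) := [set A : {set 'I_n} | A \subset B & #|A| == j].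
apply: (@leq_trans #|finset.setX (D P) (D [set: 'I_n]%SET)|).
  apply/subset_leq_card/fintype.subsetP => _ /imsetP[Q + ->].
  rewrite !inE finset.subsetDl finset.subsetT /= => /andP[/eqP QP /eqP Qj].
  rewrite Qj eqxx andbT -Qj.
  (* Cancelling the common part of [P] and [Q] in [#|Q| = #|P|] gives [#|P :\: Q| = #|Q :\: P|]. *)
  move: (cardsID P Q) (cardsID Q P); rewrite finset.setIC QP => <-.
  by move/addnI/eqP.
rewrite cardsX !cards_draws cardsT card_ord.
by apply: leq_mul; apply: bin_leq_expn.
Qed.

Lemma sum_expr_lt_double (R : realFieldType) (x : R) (n : nat) :
  0 < x -> x <= 1 / 2 -> \sum_(1 <= j < n.+1) x ^+ j < 2 * x.
Proof.
move=> x0 x1.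
(* The subtracted term makes the induction close: the step amounts to [2 * x ^+ n.+2 <= x ^+ n.+1],
   which is where [x <= 1 / 2] enters. *)
suff : \sum_(1 <= j < n.+1) x ^+ j <= 2 * x - 2 * x ^+ n.+1.
  by move: (exprn_gt0 n.+1 x0); lra.
elim: n => [|n IHn]; first by rewrite big_geq// expr1 subrr.
rewrite big_nat_recr //= [x ^+ n.+2]exprS.
by move: (exprn_gt0 n.+1 x0); nra.
Qed.

Lemma sum_sets_by_distance (R : realFieldType) (n : nat) (P : {set 'I_n}) (y : R) :
  0 <= y ->
  \sum_(Q : {set 'I_n} | (#|Q| == #|P|) && (Q != P)) y ^+ #|Q :\: P|
    <= \sum_(1 <= j < #|P|.+1) (#|P|%:R * n%:R * y) ^+ j.
Proof.
move=> y0.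
rewrite (partition_big (fun Q : {set 'I_n} => inord #|Q :\: P| : 'I_(#|P|.+1))
  predT) //=.
(* [inord] does not fall back to its default here, since [Q :\: P] lies in [Q] and so has at most
   [#|P|] elements. *)
have valE (Q : {set 'I_n}) : #|Q| == #|P| ->
    (inord #|Q :\: P| : 'I_(#|P|.+1)) = #|Q :\: P| :> nat.
  move=> /eqP QP; rewrite inordK// ltnS -QP.
  exact/subset_leq_card/finset.subsetDl.
(* The class [j = 0] is empty: a subset of [P] with as many elements as [P] is [P] itself. *)
rewrite big_ord_recl big1 ?add0r; last first.
  move=> Q /andP[/andP[QP QnP] /eqP/(congr1 (@nat_of_ord _))].
  rewrite valE//= => /eqP; rewrite cards_eq0 finset.setD_eq0 => sQP.
  by move: QnP; rewrite eqEcard sQP (eqP QP) leqnn.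
rewrite big_add1 /= big_mkord; apply: ler_sum => j _.
rewrite (eq_bigr (fun=> y ^+ j.+1)); last first.
  move=> Q /andP[/andP[QP _] /eqP/(congr1 (@nat_of_ord _))].
  by rewrite valE//= => ->.
rewrite (eq_bigl [in [set Q : {set 'I_n} | [&& #|Q| == #|P|, Q != P &
  inord #|Q :\: P| == lift ord0 j]]]); last first.
  by move=> Q; rewrite inE andbA.
rewrite sumr_const -[leLHS]mulr_natl [leRHS]exprMn.
apply: ler_wpM2r; first exact: exprn_ge0.
rewrite -natrM -natrX ler_nat.
apply: leq_trans (card_sets_at_distance P j.+1); apply: subset_leq_card.
apply/fintype.subsetP => Q; rewrite !inE => /and3P[QP _ /eqP Qj].
by rewrite QP /= -valE// Qj /=.
Qed.

Lemma measure_bigsetU_le (d : measure_display) (T : measurableType d)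
    (R : realType) (mu : {measure set T -> \bar R}) (I : Type) (s : seq I)
    (D : pred I) (A : I -> set T) :
  (forall i, D i -> measurable (A i)) ->
  (mu (\big[setU/set0]_(i <- s | D i) A i) <= \sum_(i <- s | D i) mu (A i))%E.
Proof.
move=> mA; elim: s => [|i s IHs]; first by rewrite !big_nil measure0.
rewrite !big_cons; case: ifP => // Di.
apply: le_trans (measureU2 _ _ _) _; first exact: mA.
  exact: bigsetU_measurable.
by rewrite leeD2l.
Qed.

Definition clique_event (T : Type) (n : nat) (G : T -> rel 'I_n)
  (Q : {set 'I_n}) : set T := [set t | is_clique (G t) Q]%classic.

Lemma nonplanted_clique_eventE (T : Type) (n : nat) (G : T -> rel 'I_n)
    (P : {set 'I_n}) (c : nat) :
  nonplanted_clique_event G P c =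
  \big[setU/set0]_(Q : {set 'I_n} | (#|Q| == c) && (Q != P)) clique_event G Q.
Proof.
rewrite -bigcup_seq_cond; apply/seteqP; split=> t.
  move=> [Q [/eqP Qc /eqP QP Qcl]]; exists Q => //=.
  by rewrite mem_index_enum Qc.
by move=> [Q /= /andP[_ /andP[/eqP Qc /eqP QP]] Qcl]; exists Q.
Qed.

Lemma measurable_clique_event (d : measure_display) (T : measurableType d)
    (R : realType) (Pr : probability T R) (n : nat) (P : {set 'I_n}) (alpha : R)
    (G : T -> rel 'I_n) (Q : {set 'I_n}) :
  planted_clique_model Pr P alpha G -> measurable (clique_event G Q).
Proof.
case=> _ mG _ _ _.
rewrite (_ : clique_event G Q = \bigcap_(e in [set` [set e : 'I_n * 'I_n |
  [&& e.1 \in Q, e.2 \in Q & e.1 != e.2]]%SET]) edge_event G e)%classic.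
  by apply: fin_bigcap_measurable => // e _; exact: mG.
apply/seteqP; split=> [t Qcl [u v] /= | t Qcl u v uQ vQ uv].
  by rewrite inE /= => /and3P[]; exact: Qcl.
by apply: (Qcl (u, v)); rewrite /= inE /= uQ vQ.
Qed.

(** Forgetting the pairs inside [P] only enlarges the event, and the remaining pairs are all free,
    so independence gives the larger event probability exactly [alpha ^+ #|J|]. *)
Lemma clique_event_le (d : measure_display) (T : measurableType d)
    (R : realType) (Pr : probability T R) (n : nat) (P : {set 'I_n}) (alpha : R)
    (G : T -> rel 'I_n) (Q : {set 'I_n}) :
  planted_clique_model Pr P alpha G ->
  (Pr (clique_event G Q) <=
     (alpha ^+ #|[set e in free_pair P | (e.1 \in Q) && (e.2 \in Q)]|)%:E)%E.
Proof.
move=> model; case: (model) => _ mG _ Galpha indep.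
set J := [set e in _ | _]%SET.
have JP e : e \in J -> free_pair P e by rewrite inE => /andP[].
have -> : (alpha ^+ #|J|)%:E = Pr (\bigcap_(e in [set` J]) edge_event G e)%classic.
  rewrite indep// -prodr_const (big_morph _ (@EFinM R) erefl).
  by apply: eq_bigr => e /JP/Galpha ->.
apply: le_measure; rewrite ?inE.
- exact: measurable_clique_event model.
- by apply: fin_bigcap_measurable => // e _; exact: mG.
move=> t Qcl [u v] /=; rewrite inE /= => /and3P[/andP[/= uv _] uQ vQ].
by apply: Qcl => //; rewrite -(inj_eq val_inj) /= neq_ltn uv.
Qed.

(** Writing [alpha] as a square absorbs the factor 2 in the count of free pairs, so no exponent has
    to be halved. *)
Lemma nonplanted_clique_event_le (d : measure_display) (T : measurableType d)
    (R : realType) (Pr : probability T R) (n : nat) (P : {set 'I_n}) (alpha : R)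
    (G : T -> rel 'I_n) (b : R) :
  planted_clique_model Pr P alpha G -> 0 <= b <= 1 -> alpha = b ^+ 2 ->
  (Pr (nonplanted_clique_event G P #|P|) <=
     (\sum_(1 <= j < #|P|.+1) (#|P|%:R * n%:R * b ^+ #|P|.-1) ^+ j)%:E)%E.
Proof.
move=> model /andP[b0 b1] alphaE; rewrite nonplanted_clique_eventE.
apply: le_trans (measure_bigsetU_le _ _ _) _ => [Q _|].
  exact: measurable_clique_event model.
have bP0 : 0 <= b ^+ #|P|.-1 by exact: exprn_ge0.
apply: (@le_trans _ _ (\sum_(Q : {set 'I_n} | (#|Q| == #|P|) && (Q != P))
    (b ^+ #|P|.-1) ^+ #|Q :\: P|)%:E); last first.
  by rewrite lee_fin; exact: sum_sets_by_distance.
rewrite -sumEFin; apply: lee_sum => Q /andP[/eqP QP _].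
apply: le_trans (clique_event_le Q model) _.
(* As [b <= 1], a lower bound on the exponent suffices. *)
rewrite lee_fin alphaE -!exprM; apply: ler_wiXn2l => //.
by rewrite mul2n mulnC -QP; exact: leq_card_free_pairs.
Qed.

Lemma log2_expn (R : realType) (c : nat) : log2 ((2 ^ c)%N%:R : R) = c%:R.
Proof.
rewrite /log2 natrX lnXn// -[ln 2 *+ c]mulr_natl mulfK// gt_eqF//.
by rewrite ln_gt0 ?ltr1n.
Qed.

Lemma planted_bound_le_half (R : realType) (c : nat) : (4 <= c)%N ->
  c%:R * 2 ^+ c * (2 * c%:R)^-1 ^+ c.-1 <= 1 / 2 :> R.
Proof.
case: c => [|[|[|[|c]]]] // _.
have : 4 <= c.+4%:R :> R by rewrite ler_nat.
move: (c.+4%:R : R) => x x4.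
have xX : 1 <= x ^+ c by apply: exprn_ege1; lra.
have x0 : x != 0 by rewrite gt_eqF//; lra.
have E2 : (2 : R) ^+ c != 0 by rewrite expf_neq0// pnatr_eq0.
have Ex : x ^+ c != 0 by rewrite expf_neq0.
rewrite /= exprVn exprMn !exprS.
(* In terms of the original [c], the quantity is [2 / c ^ (c - 2)], at most 1/8 once [c >= 4]. *)
have -> : x * (2 * (2 * (2 * (2 * 2 ^+ c)))) /
   (2 * (2 * (2 * 2 ^+ c)) * (x * (x * (x * x ^+ c)))) = 2 / (x ^+ 2 * x ^+ c).
  by field; rewrite E2 Ex x0.
rewrite ler_pdivrMr; nra.
Qed.

Theorem theorem1 (R : realType) :
  exists (k0 alpha : nat -> R) (n0 : nat),
    [/\ at_most_polylog k0,
        at_most_polylog (fun n => (alpha n)^-1)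
      & forall c n : nat, (0 < c)%N -> n = (2 ^ c)%N -> (n0 <= n)%N ->
        [/\ 0 < k0 n,
            0 < alpha n <= 1,
            alpha n <= 1 / (2 * k0 n)
          & forall (d : measure_display) (T : measurableType d)
                   (Pr : probability T R) (P : {set 'I_n}) (G : T -> rel 'I_n),
              #|P| = c ->
              planted_clique_model Pr P (alpha n) G ->
              (Pr (nonplanted_clique_event G P c)
                 < (2 * (c%:R * 2 ^+ c) / (2 * c%:R) ^+ (c - 1))%:E)%E]].
Proof.
(* At [n = 2 ^ c] this is [k0 = 2 c^2] and [alpha = 1 / (2 k0) = (1 / (2 c))^2], so [b = 1 / (2 c)]
   is the square root needed for the union bound. The threshold 16 is [2 ^ 4], which forces
   [c >= 4]. *)
exists (fun n => 2 * log2 n%:R ^+ 2), (fun n => (4 * log2 n%:R ^+ 2)^-1), 16%N.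
split.
- by exists 2, 2%N; near=> n.
- by exists 4, 2%N; near=> n; rewrite invrK.
move=> c n c0 -> n16; rewrite log2_expn.
have c4 : (4 <= c)%N by rewrite -(leq_exp2l (m := 2)).
have c1 : 1 <= c%:R :> R by rewrite ler1n.
split.
- by nra.
- by rewrite invr_gt0 invf_le1; nra.
- by rewrite div1r mulrA -natrM.
move=> d T Pr P G Pc model.
have b01 : 0 <= (2 * c%:R : R)^-1 <= 1.
  by rewrite invr_ge0 invf_le1; nra.
have alphaE : (4 * c%:R ^+ 2)^-1 = (2 * c%:R)^-1 ^+ 2 :> R.
  by rewrite exprVn; congr (_ ^-1); ring.
rewrite -[X in nonplanted_clique_event _ _ X]Pc.
apply: le_lt_trans (nonplanted_clique_event_le model b01 alphaE) _.
rewrite Pc lte_fin natrX.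
(* Twice the ratio of the geometric sum is exactly the claimed bound. *)
apply: lt_le_trans (sum_expr_lt_double _ _ _) _.
- by rewrite !mulr_gt0 ?exprn_gt0 ?invr_gt0 ?mulr_gt0 ?ltr0n.
- exact: planted_bound_le_half.
by rewrite subn1 exprVn !mulrA.
Unshelve. all: by end_near.
Qed.
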